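(* Let $m\ge1$, $n\ge1$ be integers, let $a_m$ be a real constant, let $\Delta t,\Delta x>0$, put $N=nm+1$, and let $\{k_1,\dots,k_N\}$ be a set of $N$ (distinct) integers. Let $\nu_m=\dfrac{\Delta t\,a_m}{\Delta x^m}$. Consider the $n$th-order time-marching scheme $$u(x,\Delta t)=\sum_{i=1}^{N}c_i\,u(x+k_i\Delta x,0)$$ for solving $\dfrac{\partial u}{\partial t}=a_m\partial_x^m u$, whose coefficients $\{c_i\}$ satisfy the $N=nm+1$ order conditions: for $\ell=0,1,\dots,nm$, $$\sum_{i=1}^N c_i k_i^{\ell}=\begin{cases}(jm)!\,\dfrac{\nu_m^j}{j!}, & \ell=jm,\ 0\le j\le n,\\[2mm] 0, & m\nmid \ell.\end{cases}$$ Then the coefficients have the closed-form solution $$c_i=\sum_{j=0}^n\frac{\nu_m^j}{j!}\,L_i^{(jm)}(0),\qquad i=1,\dots,N,$$ where $L_i^{(jm)}(0)$ is the $(jm)$th-order derivative, evaluated at the origin, of the Lagrange polynomial of degree $N-1=nm$ $$L_i(x)=\prod_{\substack{j=1\\ j\ne i}}^{N}\frac{x-k_j}{k_i-k_j}.$$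
   Context: The number $\nu_m$ is called the generalized Courant number. The order conditions express that the formal power series $e^{\Delta t\,a_m\partial_x^m}$ and $\sum_{i=1}^N c_i e^{k_i\Delta x\,\partial_x}$ in $\partial_x$ agree through the power $\partial_x^{nm}$. Conventions: $0^0=1$, and $L_i^{(0)}=L_i$. *)

(* Defs.v *)
From mathcomp Require Import all_boot all_order all_algebra.
From mathcomp Require Import reals.

Set Implicit Arguments.
Unset Strict Implicit.
Unset Printing Implicit Defensive.

Import GRing.Theory Num.Theory.
Local Open Scope ring_scope.

(* The generalized Courant number of the equation u_t = a (d/dx)^m u. *)
Definition courant (R : realType) (m : nat) (a dt dx : R) : R :=
  dt * a / dx ^+ m.

(* The conditions on the coefficients of the scheme
     u(x, dt) = \sum_i c_i u(x + k_i dx, 0)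
   saying that the power series exp (dt a d^m) and
   \sum_i c_i exp (k_i dx d) in d agree up to d^(n * m), where nu = dt a / dx^m.
   Note that 0 ^+ 0 = 1, so a shift k_i = 0 contributes c_i for l = 0. *)
Definition order_conditions (R : realType) (m n : nat) (nu : R)
    (k : 'I_(n * m + 1) -> int) (c : 'I_(n * m + 1) -> R) : Prop :=
  (forall j : nat, (j <= n)%N ->
     \sum_i c i * (k i)%:~R ^+ (j * m) =
       (j * m)`!%:R * (nu ^+ j / j`!%:R)) /\
  (forall l : nat, (l <= n * m)%N -> ~~ (m %| l)%N ->
     \sum_i c i * (k i)%:~R ^+ l = 0).

(* The theory of x.-lagrange in qpoly needs nodes x : nat -> K injective on all
   of nat; here only finitely many nodes are given. *)
Definition lagrange_poly (R : realType) (N : nat) (x : 'I_N -> R) (i : 'I_N) :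
    {poly R} :=
  \prod_(j < N | j != i) ((x i - x j)^-1 *: ('X - (x j)%:P)).

(* Main.v *)
Require Import Defs.
From mathcomp Require Import all_boot all_order all_algebra.
From mathcomp Require Import reals.

Set Implicit Arguments.
Unset Strict Implicit.
Unset Printing Implicit Defensive.

Import GRing.Theory Num.Theory.
Local Open Scope ring_scope.

(* The order conditions prescribe the moments \sum_j c_j k_j^l for every l up to
   the degree of L_i. Since L_i(k_j) is 1 if j = i and 0 otherwise,
   c_i = \sum_j c_j L_i(k_j); expanding L_i in monomials turns this into a
   combination of the moments, of which only those with m | l survive. The
   coefficient of degree d of L_i is its d-th derivative at 0 over d!. *)

Lemma horner_lagrange_poly (R : realType) (N : nat) (x : 'I_N -> R)
    (i l : 'I_N) : injective x -> (lagrange_poly x i).[x l] = (l == i)%:R.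
Proof.
move=> x_inj; rewrite /lagrange_poly horner_prod; have [->|neq_li] := eqVneq l i.
  apply: big1 => j neq_ji; rewrite !hornerE mulVf // subr_eq0.
  by apply: contra neq_ji => /eqP/x_inj ->.
by rewrite (bigD1 l) //= !hornerE subrr mulr0 mul0r.
Qed.

(** Up to a scalar, [N - 1] monic linear factors are multiplied. With [N = n * m + 1], the monomials
    that occur have exponent at most [n * m], exactly the range of the prescribed moments. *)
Lemma size_lagrange_poly (R : realType) (N : nat) (x : 'I_N -> R) (i : 'I_N) :
  (size (lagrange_poly x i) <= N)%N.
Proof.
rewrite /lagrange_poly scaler_prod (leq_trans (size_scale_leq _ _)) //.
rewrite -big_filter size_prod_XsubC size_filter.
have -> : count (predC1 i) (index_enum 'I_N) = #|predC1 i|.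
  by rewrite cardE size_filter /index_enum -enumT; apply/permP/perm_refl.
(* The index [i] itself witnesses [0 < N], whence [N.-1.+1 = N]. *)
by rewrite cardC1 card_ord prednK // (leq_ltn_trans _ (ltn_ord i)).
Qed.

Lemma horner0_derivn (R : nzRingType) (p : {poly R}) (d : nat) :
  p^`(d).[0] = p`_d *+ d`!.
Proof. by rewrite horner_coef0 coef_derivn addn0 ffactnn. Qed.

(** Induction on [n]: the new indices run from [n * m + 1] to [n.+1 * m], and only the last of them
    is a multiple of [m]. *)
Lemma sum_nat_multiples (V : nmodType) (m n : nat) (F : nat -> V) :
  (0 < m)%N ->
  (forall l, (l <= n * m)%N -> ~~ (m %| l)%N -> F l = 0) ->
  \sum_(0 <= l < n * m + 1) F l = \sum_(0 <= j < n.+1) F (j * m)%N.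
Proof.
move=> m_gt0; elim: n => [|n IHn] F0; first by rewrite !big_nat1.
have le_nm : (n * m <= n.+1 * m)%N by rewrite leq_mul2r leqnSn orbT.
rewrite [RHS]big_nat_recr //= -IHn; last first.
  by move=> l le_l; apply: F0; apply: leq_trans le_nm.
rewrite addn1 big_nat_recr //= (@big_cat_nat _ _ _ (n * m + 1)%N) //=; last first.
  by rewrite addn1 mulSn -[X in (X < _)%N]add0n ltn_add2r.
congr (_ + _); rewrite -[RHS]addr0; congr (_ + _).
rewrite big_nat_cond; apply: big1 => l; rewrite andbT addn1 => /andP[lt_nl lt_ln].
(* A multiple [q * m] strictly between [n * m] and [n.+1 * m] would force [n < q < n.+1]. *)
apply: F0 (ltnW lt_ln) _; apply/negP => /dvdnP[q def_l].
move: lt_nl lt_ln; rewrite def_l !ltn_pmul2r // ltnS => lt_nq /(leq_trans lt_nq).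
by rewrite ltnn.
Qed.

Theorem theorem2 (R : realType) (m n : nat) (a dt dx : R)
    (k : 'I_(n * m + 1) -> int) (c : 'I_(n * m + 1) -> R) :
  (1 <= m)%N -> (1 <= n)%N -> 0 < dt -> 0 < dx -> injective k ->
  order_conditions (courant m a dt dx) k c ->
  forall i : 'I_(n * m + 1),
    c i = \sum_(0 <= j < n.+1)
            courant m a dt dx ^+ j / j`!%:R *
              (lagrange_poly (fun l => (k l)%:~R) i)^`(j * m).[0].
Proof.
move=> m_gt0 _ _ _ k_inj [mom_mul mom0] i.
set p := lagrange_poly _ i.
have x_inj : injective (fun l => (k l)%:~R : R).
  by move=> u v /intr_inj/k_inj.
pose mom l := \sum_j c j * (k j)%:~R ^+ l.
have -> : c i = \sum_(0 <= l < n * m + 1) p`_l * mom l.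
  transitivity (\sum_j c j * p.[(k j)%:~R]).
    rewrite (bigD1 i) //= /p (horner_lagrange_poly i i x_inj) eqxx mulr1.
    rewrite big1 ?addr0 // => j /negPf neq_ji.
    by rewrite (horner_lagrange_poly i j x_inj) neq_ji mulr0.
  (* Expand each value of [p] in monomials and swap the sums: the inner sum over the nodes becomes a
     moment. *)
  under eq_bigr do
    rewrite (horner_coef_wide _ (size_lagrange_poly _ _)) mulr_sumr.
  rewrite exchange_big big_mkord; apply: eq_bigr => l _.
  by rewrite mulr_sumr; apply: eq_bigr => j _; rewrite mulrCA.
rewrite sum_nat_multiples //; last first.
  by move=> l le_l /(mom0 _ le_l) mom_l; rewrite /mom mom_l mulr0.
rewrite [LHS]big_nat_cond [RHS]big_nat_cond.
apply: eq_bigr => j; rewrite andbT ltnS => /= le_jn.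
(* The factor [(j * m)!] of the moment turns the coefficient of [p] into its derivative at 0. *)
by rewrite /mom mom_mul // horner0_derivn -[p`__ *+ _]mulr_natr [RHS]mulrC -[RHS]mulrA.
Qed.
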